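(* Let $G$ be a group and let $A$ be a finite dimensional $G$-graded algebra over a field $k$. If $A$ is graded semisimple, then $A$ is graded Frobenius. In particular, if $A$ is a graded division algebra, then $A$ is graded Frobenius.
   Context: A $G$-graded algebra $A$ is graded semisimple if it is a direct sum of minimal graded left ideals. A graded division algebra is a non-zero graded algebra in which every non-zero homogeneous element is invertible. $A-gr$ denotes the category of $G$-graded left $A$-modules (with degree-preserving $A$-linear maps). The dual space $A^*=\mathrm{Hom}_k(A,k)$ is a graded left $A$-module with $(af)(x)=f(xa)$ and grading $(A^* )_g=\{f\in A^* \mid f(A_h)=0 \text{ for any } h\neq g^{-1}\}$. $A$ is called graded Frobenius if $A\simeq A^*$ in $A-gr$. *)

(* Defs.v *)
From HB Require Import structures.
From mathcomp Require Import all_boot all_algebra.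

Set Implicit Arguments.
Unset Strict Implicit.
Unset Printing Implicit Defensive.

Import GRing.Theory.
Local Open Scope ring_scope.

(* falgType forces 1 != 0, whereas the zero algebra is a finite dimensional
   algebra like any other; hence this structure, whose underlying ring is a
   pzRingType. *)
HB.mixin Record Vector_isPzAlgebra (k : fieldType) A of Vector k A := {
  alg_one : A;
  alg_mul : A -> A -> A;
  alg_mulA : associative alg_mul;
  alg_mul1l : left_id alg_one alg_mul;
  alg_mul1r : right_id alg_one alg_mul;
  alg_mulDl : left_distributive alg_mul +%R;
  alg_mulDr : right_distributive alg_mul +%R;
  alg_mulZl : forall (c : k) (x y : A), alg_mul (c *: x) y = c *: alg_mul x y;
  alg_mulZr : forall (c : k) (x y : A), alg_mul x (c *: y) = c *: alg_mul x y
}.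

#[short(type="finDimAlgType")]
HB.structure Definition FinDimAlg (k : fieldType) :=
  {A of Vector k A & Vector_isPzAlgebra k A}.

HB.instance Definition _ (k : fieldType) (A : finDimAlgType k) :=
  GRing.Zmodule_isPzRing.Build (FinDimAlg.sort A)
    alg_mulA alg_mul1l alg_mul1r alg_mulDl alg_mulDr.

(* Makes 'lmodType A' mean: left module over the ring A. *)
Coercion alg_ring (k : fieldType) (A : finDimAlgType k) : pzRingType :=
  FinDimAlg.sort A.

(* In a product with a scaled factor, the type annotation on that factor is
   needed, as otherwise a nonzero lSemiAlgType is inferred. *)
Lemma alg_scalerAl (k : fieldType) (A : finDimAlgType k) (c : k) (x y : A) :
  (c *: x : A) * y = c *: (x * y).
Proof. exact: alg_mulZl. Qed.

Lemma alg_scalerAr (k : fieldType) (A : finDimAlgType k) (c : k) (x y : A) :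
  x * (c *: y : A) = c *: (x * y).
Proof. exact: alg_mulZr. Qed.

(* V is the internal direct sum of the additive subgroups C j. The index type J
   may be infinite, so every sum is over a finite subfamily. *)
Record is_direct_sum (V : zmodType) (J : eqType) (C : J -> V -> Prop) : Prop := {
  dsum0 : forall j, C j 0;
  dsumB : forall j x y, C j x -> C j y -> C j (x - y);
  dsum_span : forall v : V, exists2 s : seq J, uniq s &
    exists2 w : J -> V, (forall j, C j (w j)) & v = \sum_(j <- s) w j;
  dsum_indep : forall (s : seq J) (w : J -> V), uniq s ->
    (forall j, C j (w j)) -> \sum_(j <- s) w j = 0 ->
    forall j, j \in s -> w j = 0
}.

Record grading (G : groupType) (k : fieldType) (A : finDimAlgType k) := Grading {
  grading_comp :> G -> {vspace A};
  grading_dsum : is_direct_sum (fun g (x : A) => x \in grading_comp g);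
  grading_mul : forall (g h : G) (x y : A),
    x \in grading_comp g -> y \in grading_comp h ->
    x * y \in grading_comp (g * h)%g
}.

(* The objects of A-gr. *)
Record gr_module (G : groupType) (k : fieldType) (A : finDimAlgType k)
    (gA : grading G A) := GrModule {
  gr_carrier :> lmodType A;
  gr_comp : G -> gr_carrier -> Prop;
  gr_dsum : is_direct_sum gr_comp;
  gr_act : forall (g h : G) (a : A) (m : gr_carrier),
    a \in gA g -> gr_comp h m -> gr_comp (g * h)%g (a *: m)
}.

(* The morphisms of A-gr. *)
Definition degree_preserving (G : groupType) (k : fieldType)
    (A : finDimAlgType k) (gA : grading G A) (M N : gr_module gA)
    (f : {linear M -> N}) : Prop :=
  forall (g : G) (m : M), gr_comp g m -> gr_comp g (f m).

Definition gr_isomorphic (G : groupType) (k : fieldType)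
    (A : finDimAlgType k) (gA : grading G A) (M N : gr_module gA) : Prop :=
  exists (f : {linear M -> N}) (f' : {linear N -> M}),
    [/\ degree_preserving f, degree_preserving f', cancel f f' & cancel f' f].

Section Regular.
Variables (G : groupType) (k : fieldType) (A : finDimAlgType k).
Variable gA : grading G A.

Definition regular_gr : gr_module gA :=
  @GrModule G k A gA A^o (fun g x => x \in gA g) (grading_dsum gA)
    (@grading_mul _ _ _ gA).

End Regular.

Section Dual.
Variables (k : fieldType) (A : finDimAlgType k).

(* An alias, so that its scalars can be A rather than k. *)
Definition dual : Type := 'Hom(A, k^o).
HB.instance Definition _ := GRing.Zmodule.copy dual 'Hom(A, k^o).

Definition dual_eval (f : dual) (x : A) : k := (f : 'Hom(A, k^o)) x.

Definition mulr_by (a x : A) : A := x * a.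

Fact mulr_by_linear a : linear (mulr_by a).
Proof. by move=> c x y; rewrite /mulr_by mulrDl alg_scalerAl. Qed.

HB.instance Definition _ a :=
  GRing.isLinear.Build k A A _ (mulr_by a) (mulr_by_linear a).

Definition dual_act (a : A) (f : dual) : dual :=
  ((f : 'Hom(A, k^o)) \o linfun (mulr_by a))%VF.

Lemma dual_actE a f x : dual_eval (dual_act a f) x = dual_eval f (x * a).
Proof. by rewrite /dual_eval /dual_act comp_lfunE lfunE. Qed.

Lemma dualP (f f' : dual) : (forall x, dual_eval f x = dual_eval f' x) -> f = f'.
Proof. by move=> e; apply/lfunP. Qed.

Lemma dual_evalD f f' x : dual_eval (f + f') x = dual_eval f x + dual_eval f' x.
Proof. exact: (@add_lfunE k A k^o f f' x). Qed.

Lemma dual_evalN f x : dual_eval (- f) x = - dual_eval f x.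
Proof. exact: (@opp_lfunE k A k^o f x). Qed.

Lemma dual_evalB f f' x : dual_eval (f - f') x = dual_eval f x - dual_eval f' x.
Proof. by rewrite dual_evalD dual_evalN. Qed.

Lemma dual_eval0 x : dual_eval 0 x = 0.
Proof. exact: (@zero_lfunE k A k^o x). Qed.

Lemma dual_eval_sum (I : Type) (r : seq I) (F : I -> dual) x :
  dual_eval (\sum_(i <- r) F i) x = \sum_(i <- r) dual_eval (F i) x.
Proof.
apply: (big_morph (dual_eval^~ x)) => [f f'|]; [exact: dual_evalD | exact: dual_eval0].
Qed.

Fact dual_actA a b f : dual_act a (dual_act b f) = dual_act (a * b) f.
Proof. by apply: dualP => x; rewrite !dual_actE mulrA. Qed.

Fact dual_act1 : left_id 1 dual_act.
Proof. by move=> f; apply: dualP => x; rewrite dual_actE mulr1. Qed.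

Fact dual_actDr : right_distributive dual_act +%R.
Proof.
by move=> a f f'; apply: dualP => x; rewrite dual_evalD !dual_actE dual_evalD.
Qed.

Fact dual_actDl f : {morph dual_act^~ f : a b / a + b}.
Proof.
move=> a b; apply: dualP => x.
by rewrite dual_evalD !dual_actE mulrDr /dual_eval linearD.
Qed.

HB.instance Definition _ := GRing.Zmodule_isLmodule.Build A dual
  dual_actA dual_act1 dual_actDr dual_actDl.

End Dual.

Section DualGrading.
Variables (G : groupType) (k : fieldType) (A : finDimAlgType k).
Variable gA : grading G A.

Definition dual_comp (g : G) (f : dual A) : Prop :=
  forall h : G, h != (g^-1)%g -> forall x : A, x \in gA h -> dual_eval f x = 0.


Lemma grading_finite :
  exists2 S : seq G, uniq S & (\sum_(g <- S) gA g)%VS = fullv.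
Proof.
suff [S uS sub] : exists2 S : seq G, uniq S &
    {subset (vbasis fullv : seq A) <= (\sum_(g <- S) gA g)%VS}.
  exists S => //; apply/eqP; rewrite eqEsubv subvf /=.
  by rewrite -(span_basis (vbasisP fullv)); apply/span_subvP.
elim: (vbasis fullv : seq A) => [|x e [S uS sub]]; first by exists [::] => [|y]; rewrite ?in_nil.
have [s us [w wP xE]] := dsum_span (grading_dsum gA) x.
have mono (s1 s2 : seq G) : uniq s1 -> uniq s2 -> {subset s1 <= s2} ->
    (\sum_(g <- s1) gA g <= \sum_(g <- s2) gA g)%VS.
  move=> us1 us2 s12; rewrite big_tnth; apply/subv_sumP => i _.
  have gs2 := s12 _ (mem_tnth i (in_tuple s1)).
  by rewrite (bigD1_seq _ gs2 us2) /=; apply: addvSl.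
exists (undup (s ++ S)); first exact: undup_uniq.
move=> y; rewrite inE => /predU1P[->|/sub yS].
  have /subvP : (\sum_(g <- s) gA g <= \sum_(g <- undup (s ++ S)) gA g)%VS.
    by apply: mono; rewrite ?undup_uniq // => g gs; rewrite mem_undup mem_cat gs.
  apply; rewrite xE; elim: (s) => [|g r IH]; first by rewrite !big_nil mem0v.
  by rewrite !big_cons memv_add.
have /subvP : (\sum_(g <- S) gA g <= \sum_(g <- undup (s ++ S)) gA g)%VS.
  apply: mono; rewrite ?undup_uniq // => g gS.
  by rewrite mem_undup mem_cat gS orbT.
exact.
Qed.

Lemma grading_proj0 (S : seq G) (w : G -> A) (h : G) :
    uniq S -> (forall g, w g \in gA g) -> \sum_(g <- S) w g \in gA h ->
  forall g, g \in S -> g != h -> w g = 0.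
Proof.
move=> uS wP; set x := \sum_(g <- S) w g => xh g gS ngh.
have gD := grading_dsum gA.
pose w' (l : G) : A := (if l \in S then w l else 0) - (if l == h then x else 0).
have w'P l : w' l \in gA l.
  apply: rpredB; first by case: ifP; rewrite ?mem0v.
  by case: eqP => [->|_]; rewrite ?mem0v.
have -> : w g = w' g by rewrite /w' gS (negPf ngh) subr0.
have wS : \sum_(l <- S) (if l \in S then w l else 0) = x.
  by rewrite big_seq [RHS]big_seq; apply: eq_bigr => l ->.
have [hS|hS] := boolP (h \in S).
  apply: (dsum_indep gD uS w'P) => //.
  rewrite sumrB wS (bigD1_seq h) //= eqxx big1 ?addr0 ?subrr // => l.
  by move/negPf->.
apply: (dsum_indep gD (s := h :: S) (w := w')) => //.
- by rewrite /= hS.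
- rewrite big_cons sumrB wS {1}/w' (negPf hS) eqxx sub0r.
  rewrite [X in _ + (_ - X)]big_seq big1 ?subr0 ?addNr // => l lS.
  by case: eqP => // lh; rewrite -lh lS in hS.
- by rewrite inE gS orbT.
Qed.

Fact dual_dsum_span (f : dual A) : exists2 s : seq G, uniq s &
  exists2 w : G -> dual A, (forall g, dual_comp g (w g)) &
    f = \sum_(g <- s) w g.
Proof.
have [S uS SE] := grading_finite.
pose p (g : G) : 'End(A) := sumv_pi_for (esym SE) g.
have pm x g : p g x \in gA g by apply: memv_sum_pi.
have pE x : \sum_(g <- S) p g x = x.
  by rewrite (sumv_pi_uniq_sum (esym SE)) ?memvf // filter_predT.
exists [seq (g^-1)%g | g <- S]; first by rewrite map_inj_uniq //; apply: invg_inj.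
exists (fun g => if (g^-1)%g \in S then
    ((f : 'Hom(A, k^o)) \o p (g^-1)%g)%VF : dual A else 0).
  move=> g h hg x xh; case: ifP => gS; last exact: dual_eval0.
  rewrite /dual_eval comp_lfunE (@grading_proj0 S (p^~ x) h) ?linear0 //.
    by rewrite pE.
  by rewrite eq_sym.
rewrite big_map big_seq; apply: dualP => x.
rewrite -[x in LHS]pE /dual_eval linear_sum -[RHS]/(dual_eval _ x).
rewrite -big_seq dual_eval_sum; apply: eq_big_seq => g gS.
by rewrite invgK gS /dual_eval comp_lfunE.
Qed.

Fact dual_is_direct_sum : is_direct_sum dual_comp.
Proof.
split=> [g h _ x _|g f f' fg f'g h hg x xh|f|s w us wP w0 j js].
- exact: dual_eval0.
- by rewrite dual_evalB (fg h) // (f'g h) // subrr.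
- exact: dual_dsum_span.
apply: dualP => x; rewrite dual_eval0.
have wx0 h y : y \in gA h -> dual_eval (w j) y = 0.
  have [-> yj|hj] := eqVneq h (j^-1)%g; last exact: wP.
  have := congr1 (fun f : dual A => dual_eval f y) w0; rewrite /= dual_eval0 dual_eval_sum.
  rewrite (bigD1_seq j) //= big1 ?addr0 // => i ij.
  by rewrite (wP i (j^-1)%g) // (inj_eq invg_inj) eq_sym.
have [t ut [y yP ->]] := dsum_span (grading_dsum gA) x.
rewrite /dual_eval linear_sum big1 // => h _; exact: wx0 (yP h).
Qed.

Fact dual_comp_act (g h : G) (a : A) (f : dual A) :
  a \in gA g -> dual_comp h f -> dual_comp (g * h)%g (a *: f).
Proof.
move=> ag fh l lgh x xl; rewrite [LHS]dual_actE.
apply: fh (grading_mul xl ag); apply: contraNneq lgh => lg.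
by rewrite invgM -lg mulgK.
Qed.

Definition dual_gr : gr_module gA :=
  GrModule dual_is_direct_sum dual_comp_act.

End DualGrading.

Section Notions.
Variables (G : groupType) (k : fieldType) (A : finDimAlgType k).
Variable gA : grading G A.

Definition graded_frobenius : Prop :=
  gr_isomorphic (regular_gr gA) (dual_gr gA).

(* I is the sum of its subspaces I :&: gA g. A left ideal of a unital algebra is
   a linear subspace, so taking I to be one loses nothing. *)
Definition graded_left_ideal (I : {vspace A}) : Prop :=
  (forall a x : A, x \in I -> a * x \in I) /\
  (forall x : A, x \in I -> exists2 s : seq G, uniq s &
    exists2 w : G -> A, (forall g, w g \in (I :&: gA g)%VS) &
      x = \sum_(g <- s) w g).

Definition minimal_graded_left_ideal (I : {vspace A}) : Prop :=
  [/\ graded_left_ideal I, I <> 0%VS &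
      forall J : {vspace A}, graded_left_ideal J -> (J <= I)%VS ->
        J = 0%VS \/ J = I].

Definition graded_semisimple : Prop :=
  exists (J : eqType) (I : J -> {vspace A}),
    (forall j, minimal_graded_left_ideal (I j)) /\
    is_direct_sum (fun j (x : A) => x \in I j).

Definition graded_division : Prop :=
  (exists x : A, x <> 0) /\
  (forall (g : G) (a : A), a \in gA g -> a <> 0 ->
    exists b : A, a * b = 1 /\ b * a = 1).

End Notions.

(* Main.v *)
From HB Require Import structures.
Require Import Defs.
From mathcomp Require Import all_boot all_algebra.

Set Implicit Arguments.
Unset Strict Implicit.
Unset Printing Implicit Defensive.

Import GRing.Theory.
Local Open Scope ring_scope.

(** It suffices to find a linear form [l] on [A] that vanishes on every component
    other than the neutral one and is nondegenerate: no nonzero homogeneous [a] of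
    degree [g] satisfies [l (x * a) = 0] for all [x] of degree [g^-1]. Then
    [a |-> a l] is a degree preserving morphism from [A] to its dual, it is
    injective, and by equality of dimensions it is an isomorphism.

    The hypothesis on [A] enters only through graded von Neumann regularity: every
    homogeneous [a] is of the form [a * b * a]. In a graded division algebra [b]
    is the inverse of [a]. In a graded semisimple algebra the graded left ideal
    [A a] has a graded complement, and if [1 = b * a + v] with [v] in the
    complement, then [a * v] lies both in [A a] and in the complement, so it is
    zero ([semisimple_regular]).

    For homogeneous [a] the element [b] can be taken of inverse degree, so [b * a]
    lies in the neutral component, and it is nonzero when [a] is. A nondegenerate
    form on the neutral component, extended by zero, is therefore nondegenerate in
    the graded sense ([graded_nondegenerate]). As the neutral component is itself
    von Neumann regular, what is left is an ungraded statement: a finite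
    dimensional von Neumann regular algebra carries a linear form whose kernel
    contains no nonzero left ideal ([regular_nondegenerate]). This is where the
    structure theory of semisimple algebras would usually be quoted. The proof
    below instead takes any form [l] and decreases the largest left ideal [N] in
    its kernel. The largest right ideal [R] in the kernel has a left unit [f].
    If [f] does not kill [N], then adding to [l] a form [x |-> m (f * x)] makes
    [N] strictly smaller. If [f] kills [N], then [N] lies in the right annihilator
    [I] of [R], which is a two-sided ideal on which [l (x * y)] is nondegenerate
    on the left; it is then nondegenerate on the right too, and [N = 0]. *)

(** * Linear forms and bilinear forms *)

Section LinearForms.
Variables (k : fieldType) (V : vectType k).

Lemma functional_neq0 (v : V) : v != 0 -> exists f : 'Hom(V, k^o), f v != 0.
Proof.
move=> vn0; have [i fi|f0] := pickP (fun i => coord (vbasis fullv) i v != 0).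
  by exists (linfun (coord (vbasis fullv) i : V -> k^o)); rewrite lfunE.
case/eqP: vn0; rewrite (coord_vbasis (memvf v)) big1 // => i _.
by move/negbFE/eqP: (f0 i) => ->; rewrite scale0r.
Qed.

(** On a finite dimensional space the Gram matrix of the form is square, so
    injectivity on one side gives injectivity on the other. *)
Lemma left_nondeg_right_nondeg (b : 'Hom(V, 'Hom(V, k^o))) (I : {vspace V}) :
    (forall x, x \in I -> (forall y, y \in I -> b x y = 0) -> x = 0) ->
  forall y, y \in I -> (forall x, x \in I -> b x y = 0) -> y = 0.
Proof.
move=> nondeg y yI y0; pose e := vbasis I.
have eI i : e`_i \in I.
  have [lt|ge] := ltnP i (size e); first exact/vbasis_mem/mem_nth.
  by rewrite nth_default ?mem0v.
pose M := \matrix_(i, j < \dim I) (b e`_i e`_j : k).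
pose c := \col_(j < \dim I) (coord e j y : k).
have Mfree : row_free M.
  apply/inj_row_free => u uM0; pose x := \sum_i u 0 i *: e`_i.
  have xE z : b x z = \sum_i u 0 i * b e`_i z.
    by rewrite linear_sum sum_lfunE; apply: eq_bigr => i _;
       rewrite linearZ scale_lfunE.
  have xe0 (j : 'I_(\dim I)) : b x e`_j = 0.
    have /matrixP/(_ 0 j) := uM0; rewrite !mxE xE => uMj.
    by apply: etrans uMj; apply: eq_bigr => i _; rewrite mxE.
  have x0 : x = 0.
    apply: nondeg => [|z zI]; first by apply: memv_suml => i _; apply: memvZ.
    rewrite (coord_vbasis zI) (linear_sum (b x)) big1 // => j _.
    by rewrite (linearZZ (b x)) [X in _ *: X]xe0 scaler0.
  apply/rowP => i; rewrite mxE.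
  by have /freeP/(_ _ x0) := basis_free (vbasisP I); apply.
have : M *m c = 0.
  apply/matrixP => i j; rewrite !mxE -[RHS](y0 e`_i (eI i)).
  rewrite [in RHS](coord_vbasis yI) linear_sum; apply: eq_bigr => l _.
  by rewrite linearZ !mxE mulrC.
move/(congr1 (mulmx (invmx M))); rewrite mulKmx -?row_free_unit // mulmx0 => c0.
rewrite (coord_vbasis yI) big1 // => j _.
by have /matrixP/(_ j 0) := c0; rewrite !mxE => ->; rewrite scale0r.
Qed.

End LinearForms.

(** * Von Neumann regular algebras of finite dimension *)

Section RegularFrobenius.
Variables (k : fieldType) (B : finDimAlgType k).

Definition von_neumann_regular : Prop :=
  forall x : B, exists b : B, x * b * x = x.

Definition mull_by (a x : B) : B := a * x.

Fact mull_by_linear a : linear (mull_by a).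
Proof. by move=> c x y; rewrite /mull_by mulrDr alg_scalerAr. Qed.

HB.instance Definition _ a :=
  GRing.isLinear.Build k B B _ (mull_by a) (mull_by_linear a).

Definition mul_form (l : 'Hom(B, k^o)) (x : B) : 'Hom(B, k^o) :=
  (l \o linfun (mull_by x))%VF.

Lemma mul_formE (l : 'Hom(B, k^o)) x y : mul_form l x y = l (x * y).
Proof. by rewrite comp_lfunE lfunE. Qed.

Fact mul_form_linear (l : 'Hom(B, k^o)) : linear (mul_form l).
Proof.
move=> c x y; apply/lfunP => z.
rewrite add_lfunE scale_lfunE !mul_formE mulrDl alg_scalerAl.
exact: linearP.
Qed.

HB.instance Definition _ l :=
  GRing.isLinear.Build k B 'Hom(B, k^o) _ (mul_form l) (mul_form_linear l).

(** The action of [a] on [l] in the dual module. As a map in [a] its kernel is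
    the largest left ideal on which [l] vanishes. *)
Definition translate (l : 'Hom(B, k^o)) (a : B) : 'Hom(B, k^o) :=
  (l \o linfun (mulr_by a))%VF.

Lemma translateE (l : 'Hom(B, k^o)) a x : translate l a x = l (x * a).
Proof. by rewrite comp_lfunE lfunE. Qed.

Fact translate_linear (l : 'Hom(B, k^o)) : linear (translate l).
Proof.
move=> c x y; apply/lfunP => z.
rewrite add_lfunE scale_lfunE !translateE mulrDr alg_scalerAr.
exact: linearP.
Qed.

HB.instance Definition _ l :=
  GRing.isLinear.Build k B 'Hom(B, k^o) _ (translate l) (translate_linear l).

Lemma mem_lker_translate (l : 'Hom(B, k^o)) a :
  reflect (forall x, l (x * a) = 0) (a \in lker (linfun (translate l))).
Proof.
rewrite memv_ker lfunE; apply: (iffP eqP) => [a0 x|a0].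
  by rewrite -translateE a0 lfunE.
by apply/lfunP => x; rewrite translateE a0 lfunE.
Qed.

Lemma mem_lker_mul_form (l : 'Hom(B, k^o)) x :
  reflect (forall y, l (x * y) = 0) (x \in lker (linfun (mul_form l))).
Proof.
rewrite memv_ker lfunE; apply: (iffP eqP) => [a0 y|a0].
  by rewrite -mul_formE a0 lfunE.
by apply/lfunP => y; rewrite mul_formE a0 lfunE.
Qed.

Lemma right_annihilator_vspace (R : {vspace B}) : exists I : {vspace B},
  forall x, x \in I <-> (forall r, r \in R -> r * x = 0).
Proof.
exists (\bigcap_(i < \dim R) lker (linfun (mull_by (vbasis R)`_i)))%VS => x.
rewrite memvE; split=> [/subv_bigcapP xI r /coord_vbasis->|x0].
  rewrite mulr_suml big1 // => i _; have := xI i isT.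
  rewrite -memvE memv_ker lfunE alg_scalerAl => /eqP /= xi0.
  by rewrite -/(mull_by _ x) xi0 scaler0.
apply/subv_bigcapP => i _; rewrite -memvE memv_ker lfunE; apply/eqP/x0.
by rewrite vbasis_mem // mem_nth ?size_tuple.
Qed.

(** A left unit for finitely many elements of [R] extends to one more element
    [x]. With [y = x - f * x] and [y = y * b * y], the element [h = y * b] of [R]
    satisfies [h * y = y], and [f + h - h * f], which is [1 - (1 - h)(1 - f)],
    fixes all that [f] fixes and also [x]. *)
Lemma right_ideal_left_unit (R : {vspace B}) :
    von_neumann_regular ->
    (forall x a, x \in R -> x * a \in R) ->
  exists2 f, f \in R & forall x, x \in R -> f * x = x.
Proof.
move=> reg Rmul.
suff [f fR fP] : exists2 f, f \in R &
    forall x : B, x \in (vbasis R : seq B) -> f * x = x.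
  exists f => // x xR.
  rewrite (coord_vbasis xR) mulr_sumr; apply: eq_bigr => i _.
  by rewrite alg_scalerAr fP // mem_nth ?size_tuple.
have : {subset (vbasis R : seq B) <= R} by move=> x; apply: vbasis_mem.
elim: (vbasis R : seq B) => [_|x s IHs sR]; first by exists 0; rewrite ?mem0v.
have [|f fR fs] := IHs; first by move=> z zs; apply: sR; rewrite inE zs orbT.
have xR : x \in R by apply: sR; rewrite mem_head.
pose y := x - f * x; have yR : y \in R by rewrite rpredB ?Rmul.
have [b yby] := reg y; pose h := y * b; have hR : h \in R by apply: Rmul.
have f'E z : (f + h - h * f) * z = f * z + h * (z - f * z).
  by rewrite mulrBl mulrDl mulrBr mulrA addrA.
exists (f + h - h * f); first by rewrite rpredB ?rpredD ?Rmul.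
move=> z; rewrite inE f'E => /predU1P[->|/fs fz].
  by rewrite -/y yby addrC subrK.
by rewrite fz subrr mulr0 addr0.
Qed.

(** Induction on the dimension of [N l], starting from the zero form. *)
Lemma regular_nondegenerate : von_neumann_regular ->
  exists l : 'Hom(B, k^o), forall a, (forall x, l (x * a) = 0) -> a = 0.
Proof.
move=> reg; pose N l := lker (linfun (translate l)).
suff [l Nl] : exists l, N l = 0%VS.
  by exists l => a /mem_lker_translate; rewrite -/(N l) Nl memv0 => /eqP.
have [n] := ubnP (\dim (N 0)); elim: n (0 : 'Hom(B, k^o)) => // n IHn l ltn.
pose R := lker (linfun (mul_form l)).
have Rmul x a : x \in R -> x * a \in R.
  move=> /mem_lker_mul_form x0; apply/mem_lker_mul_form => y.
  by rewrite -mulrA.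
have [f fR fP] := right_ideal_left_unit reg Rmul.
(* By linearity a basis of N l decides whether f kills N l. *)
have [fN|/allPn[a /vbasis_mem aN fan0]] :=
    boolP (all (fun a => f * a == 0) (vbasis (N l))).
  have RN0 r a : r \in R -> a \in N l -> r * a = 0.
    move=> rR aN; rewrite -(fP r rR) -mulrA.
    have raN : r * a \in N l.
      move/mem_lker_translate: aN => a0; apply/mem_lker_translate => x.
      by rewrite mulrA.
    rewrite (coord_vbasis raN) mulr_sumr big1 // => i _.
    by rewrite alg_scalerAr (eqP (allP fN _ _)) ?scaler0 ?mem_nth ?size_tuple.
  have [I IP] := right_annihilator_vspace R.
  exists l; apply/eqP; rewrite -subv0; apply/subvP => a aN; rewrite memv0.
  apply/eqP; apply: (@left_nondeg_right_nondeg _ _ (linfun (mul_form l)) I).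
  (* As x = x * c * x, every x * y equals some x * z with z in I, so x lies in R;
     but then x = (x * c) * x lies in R * I, which is zero. *)
  - move=> x xI x0; have xR : x \in R.
      apply/mem_lker_mul_form => y; have [c xcx] := reg x.
      have : c * x * y \in I.
        apply/IP => r rR; rewrite mulrA mulrA.
        by have /IP/(_ (r * c)) := xI; rewrite Rmul // => ->; rewrite ?mul0r.
      by move/x0; rewrite lfunE mul_formE !mulrA xcx.
    have [c <-] := reg x.
    have /IP/(_ (x * c) (Rmul _ _ xR)) -> // := xI.
  - by apply/IP => r rR; apply: RN0.
  - by move=> x _; rewrite lfunE mul_formE; move/mem_lker_translate: aN.
have [m mfa] := functional_neq0 fan0.
pose nu : 'Hom(B, k^o) := (m \o linfun (mull_by f))%VF.
have nuE x : nu x = m (f * x) by rewrite comp_lfunE lfunE.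
have l1E' x : (l + nu) x = l x + nu x by rewrite add_lfunE.
move: (l + nu) l1E' => l1 l1E.
apply: (IHn l1); rewrite ltnS in ltn; apply: leq_trans ltn.
have NS : (N l1 <= N l)%VS.
  apply/subvP => c /mem_lker_translate c0.
  (* At f * x * c the form l is zero, because f is in R, and nu takes the same
     value as at x * c, because f * f = f. *)
  have nuc x : nu (x * c) = 0.
    have := c0 (f * x); rewrite l1E nuE -mulrA.
    have/mem_lker_mul_form-> := fR.
    by rewrite add0r mulrA fP // nuE.
  apply/mem_lker_translate => x.
  by rewrite -[RHS](c0 x) l1E nuc addr0.
rewrite ltn_neqAle dimvS // andbT dimv_leqif_eq //; apply: contraNneq mfa => NE.
(* If a were still in N l1, then l1 and l would vanish at a, and so would nu. *)
move: (aN) (aN); rewrite -{1}NE.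
move=> /mem_lker_translate/(_ 1) + /mem_lker_translate/(_ 1).
by rewrite l1E !mul1r nuE => + la0; rewrite la0 add0r => ->.
Qed.

End RegularFrobenius.

(** * Homogeneous components *)

Section Components.
Variables (G : groupType) (k : fieldType) (A : finDimAlgType k).
Variable gA : grading G A.

Fact gr_support_exists :
  exists S : seq G, uniq S && ((\sum_(g <- S) gA g)%VS == fullv).
Proof. by have [S uS SE] := grading_finite gA; exists S; rewrite uS SE eqxx. Qed.

Definition gr_support : seq G := xchoose gr_support_exists.

Lemma gr_support_uniq : uniq gr_support.
Proof. by case/andP: (xchooseP gr_support_exists). Qed.

Lemma gr_support_span : fullv = (\sum_(g <- gr_support) gA g)%VS.
Proof. by case/andP: (xchooseP gr_support_exists) => _ /eqP. Qed.

(** Outside the support the component is zero, whereas [sumv_pi_for] has no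
    prescribed value there. *)
Definition gr_proj (g : G) : 'End(A) :=
  if g \in gr_support then sumv_pi_for gr_support_span g else 0.

Lemma gr_proj_mem g x : gr_proj g x \in gA g.
Proof.
rewrite /gr_proj; case: ifP => _; first exact: memv_sum_pi.
by rewrite zero_lfunE mem0v.
Qed.

Lemma gr_proj_sum x : \sum_(g <- gr_support) gr_proj g x = x.
Proof.
rewrite big_seq (eq_bigr (fun g => sumv_pi_for gr_support_span g x)).
  rewrite -big_seq (sumv_pi_uniq_sum gr_support_span) ?memvf //.
  by rewrite filter_predT gr_support_uniq.
by move=> g gS; rewrite /gr_proj gS.
Qed.

Lemma gr_proj_neq g h x : x \in gA h -> g != h -> gr_proj g x = 0.
Proof.
move=> xh gh; have [gS|gS] := boolP (g \in gr_support).
  apply: (@grading_proj0 _ _ _ gA _ (gr_proj^~ x) h gr_support_uniq) => //.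
  - by move=> l; apply: gr_proj_mem.
  - by rewrite gr_proj_sum.
by rewrite /gr_proj (negPf gS) zero_lfunE.
Qed.

Lemma gr_proj_id g x : x \in gA g -> gr_proj g x = x.
Proof.
move=> xg; rewrite -[RHS]gr_proj_sum; have [gS|gS] := boolP (g \in gr_support).
  rewrite (bigD1_seq g) ?gr_support_uniq //= big1 ?addr0 // => h hg.
  exact: gr_proj_neq xg hg.
rewrite /gr_proj (negPf gS) zero_lfunE big_seq big1 // => h hS.
by apply: (gr_proj_neq xg); apply: contraNneq gS => <-.
Qed.

Lemma homogeneous_ind (P : A -> Prop) : P 0 ->
    (forall x y, P x -> P y -> P (x + y)) ->
    (forall g x, x \in gA g -> P x) ->
  forall x, P x.
Proof.
move=> P0 PD Ph x; rewrite -(gr_proj_sum x).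
by apply: big_ind => // g _; apply/Ph/gr_proj_mem.
Qed.

Lemma gr_projMl g h x y :
  x \in gA h -> gr_proj (h * g)%g (x * y) = x * gr_proj g y.
Proof.
move=> xh; elim/homogeneous_ind: y => [|y z yE zE|l y yl].
- by rewrite mulr0 !linear0 mulr0.
- by rewrite mulrDr !linearD /= mulrDr yE zE.
have xy := grading_mul xh yl; have [->|gl] := eqVneq g l.
  by rewrite !gr_proj_id.
by rewrite (gr_proj_neq yl) // mulr0 (gr_proj_neq xy) // (inj_eq (mulgI h)).
Qed.

Lemma gr_projMr g h x y :
  x \in gA h -> gr_proj (g * h)%g (y * x) = gr_proj g y * x.
Proof.
move=> xh; elim/homogeneous_ind: y => [|y z yE zE|l y yl].
- by rewrite mul0r !linear0 mul0r.
- by rewrite mulrDl !linearD /= mulrDl yE zE.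
have yx := grading_mul yl xh; have [->|gl] := eqVneq g l.
  by rewrite !gr_proj_id.
by rewrite (gr_proj_neq yl) // mul0r (gr_proj_neq yx) // (inj_eq (mulIg h)).
Qed.

Lemma one_neutral : 1 \in gA 1%g.
Proof.
suff <- : 1 * gr_proj 1%g 1 = 1 :> A by rewrite mul1r gr_proj_mem.
elim/homogeneous_ind: {1 3}(1 : A) => [|x y xE yE|g x xg].
- by rewrite mul0r.
- by rewrite mulrDl xE yE.
by rewrite -(gr_projMl _ _ xg) mulg1 mulr1 gr_proj_id.
Qed.

(** * Graded von Neumann regularity *)

Definition graded_von_neumann_regular : Prop :=
  forall (g : G) (a : A), a \in gA g -> exists b : A, a * b * a = a.

(** The component of [b] of degree [g^-1] can replace [b], because the others do
    not contribute to the component of degree [g] of [a * b * a]. *)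
Lemma graded_regular_inverse g a :
    graded_von_neumann_regular -> a \in gA g ->
  exists2 b, b \in gA (g^-1)%g & a * b * a = a.
Proof.
move=> reg ag; have [b aba] := reg g a ag.
exists (gr_proj (g^-1)%g b); first exact: gr_proj_mem.
by rewrite -(gr_projMl _ _ ag) mulgV -(gr_projMr _ _ ag) mul1g aba gr_proj_id.
Qed.

Lemma division_regular : graded_division gA -> graded_von_neumann_regular.
Proof.
move=> [_ inv] g a ag; have [->|/eqP an0] := eqVneq a 0.
  by exists 0; rewrite !mulr0.
by have [b [ab _]] := inv g a ag an0; exists b; rewrite ab mul1r.
Qed.

Lemma graded_left_idealP (I : {vspace A}) : graded_left_ideal gA I <->
  (forall a x, x \in I -> a * x \in I) /\
  (forall g x, x \in I -> gr_proj g x \in I).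
Proof.
split=> -[Imul Igr]; split=> //.
  move=> g x xI; have [s _ [w wI ->]] := Igr x xI.
  rewrite linear_sum /=; apply: memv_suml => h _.
  have /andP[whI whh] : (w h \in I) && (w h \in gA h) by rewrite -memv_cap.
  have [->|gh] := eqVneq g h; first by rewrite gr_proj_id.
  by rewrite (gr_proj_neq whh gh) mem0v.
move=> x xI; exists gr_support; first exact: gr_support_uniq.
exists (gr_proj^~ x) => [g|]; last by rewrite gr_proj_sum.
by rewrite memv_cap Igr // gr_proj_mem.
Qed.

Lemma graded_left_ideal0 : graded_left_ideal gA 0.
Proof.
apply/graded_left_idealP; split=> [a|g] x; rewrite memv0 => /eqP->.
  by rewrite mulr0 mem0v.
by rewrite linear0 mem0v.
Qed.

Lemma graded_left_idealD I J :
    graded_left_ideal gA I -> graded_left_ideal gA J ->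
  graded_left_ideal gA (I + J).
Proof.
move=> /graded_left_idealP[Im Ip] /graded_left_idealP[Jm Jp].
apply/graded_left_idealP; split=> [a|g] _ /memv_addP[x xI [y yJ ->]].
  by rewrite mulrDr memv_add ?Im ?Jm.
by rewrite linearD memv_add ?Ip ?Jp.
Qed.

Lemma graded_left_idealI I J :
    graded_left_ideal gA I -> graded_left_ideal gA J ->
  graded_left_ideal gA (I :&: J).
Proof.
move=> /graded_left_idealP[Im Ip] /graded_left_idealP[Jm Jp].
apply/graded_left_idealP; split=> [a|g] x; rewrite !memv_cap => /andP[xI xJ].
  by rewrite Im ?Jm.
by rewrite Ip ?Jp.
Qed.

Lemma principal_graded_left_ideal g a :
  a \in gA g -> graded_left_ideal gA (limg (linfun (mulr_by a))).
Proof.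
move=> ag; apply/graded_left_idealP; split=> [b|h] _ /memv_imgP[x _ ->].
  rewrite lfunE /= /mulr_by mulrA -/(mulr_by a _).
  by rewrite -[mulr_by _ _]lfunE memv_img ?memvf.
rewrite lfunE /= /mulr_by -[h](mulgVK g) (gr_projMr _ _ ag) -/(mulr_by a _).
by rewrite -[mulr_by _ _]lfunE memv_img ?memvf.
Qed.

(** Since [1] lies in a finite sum of minimal ideals [L j], these finitely many
    already span. They are added one at a time to [C], skipping those contained in
    [I + C]; by minimality any other [L j] meets [I + C] trivially. *)
Lemma graded_complement I :
    graded_semisimple gA -> graded_left_ideal gA I ->
  exists2 C, graded_left_ideal gA C & (I :&: C = 0)%VS /\ (I + C = fullv)%VS.
Proof.
move=> [J [L [minL dsumL]]] Igr.
have [s _ [w wL w1]] := dsum_span dsumL 1.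
suff [C Cgr [IC0 sC]] : exists2 C, graded_left_ideal gA C &
    (I :&: C = 0)%VS /\ {in s, forall j, (L j <= I + C)%VS}.
  exists C => //; split=> //; apply/eqP; rewrite eqEsubv subvf /=.
  apply/subvP => x _; rewrite -[x]mulr1 w1 mulr_sumr big_seq.
  apply: memv_suml => j js; apply: (subvP (sC j js)).
  by case: (minL j) => -[Lm _] _ _; apply: Lm.
elim: s {w1} => [|j s [C Cgr [IC0 sC]]].
  by exists 0%VS; [exact: graded_left_ideal0 | rewrite capv0].
have [Lgr _ Lmin] := minL j.
have ICgr := graded_left_idealD Igr Cgr.
have [LIC0|LIC] :=
    Lmin _ (graded_left_idealI Lgr ICgr) (capvSl _ _); last first.
  exists C => //; split=> // i; rewrite inE => /predU1P[->|/sC//].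
  by rewrite -LIC capvSr.
exists (C + L j)%VS; first exact: graded_left_idealD.
split=> [|i].
  apply/eqP; rewrite -subv0; apply/subvP => x /memv_capP[xI].
  move=> /memv_addP[c cC [y yL xE]].
  have yIC : y \in (L j :&: (I + C))%VS.
    rewrite memv_cap yL -[y](addKr c) -xE addrC.
    by rewrite memv_add ?memvN.
  move: yIC; rewrite LIC0 memv0 => /eqP y0.
  by rewrite -IC0 memv_cap xI xE y0 addr0.
rewrite inE addvA => /predU1P[->|/sC LIC]; first exact: addvSr.
exact: subv_trans LIC (addvSl _ _).
Qed.

Lemma semisimple_regular : graded_semisimple gA -> graded_von_neumann_regular.
Proof.
move=> ss g a ag; have Aa_gr := principal_graded_left_ideal ag.
have [C [Cm _] [AaC0 AaC1]] := graded_complement ss Aa_gr.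
have /memv_addP[u uAa [v vC uv1]] : 1 \in (limg (linfun (mulr_by a)) + C)%VS.
  by rewrite AaC1 memvf.
have av0 : a * v = 0.
  apply/eqP; rewrite -memv0 -AaC0 memv_cap Cm // andbT.
  have -> : a * v = a - a * u by rewrite -{2}[a]mulr1 uv1 mulrDr addrC addKr.
  case: Aa_gr => Aam _; rewrite rpredB ?Aam //.
  by apply/memv_imgP; exists 1; rewrite ?memvf // lfunE /= /mulr_by mul1r.
have /memv_imgP[b _ uE] := uAa; exists b.
move: uv1; rewrite uE lfunE /= /mulr_by => uv1.
by rewrite -[RHS]mulr1 uv1 mulrDr av0 addr0 mulrA.
Qed.

End Components.

(** * The neutral component *)

Section NeutralComponent.
Variables (G : groupType) (k : fieldType) (A : finDimAlgType k).
Variable gA : grading G A.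

(** An alias, so that the multiplication of [A] can be put on it. *)
Definition neutral : Type := subvs_of (gA 1%g).
HB.instance Definition _ := Vector.copy neutral (subvs_of (gA 1%g)).

Definition neutral_val (x : neutral) : A := vsval x.

Lemma neutral_valP x : neutral_val x \in gA 1%g.
Proof. exact: subvsP. Qed.

Lemma neutral_val_inj : injective neutral_val.
Proof. exact: val_inj. Qed.

Lemma neutral_val_linear : linear neutral_val.
Proof. exact: linearP. Qed.

HB.instance Definition _ :=
  GRing.isLinear.Build k neutral A _ neutral_val neutral_val_linear.

Definition neutral_proj (x : A) : neutral := vsproj (gA 1%g) (gr_proj gA 1%g x).

Lemma neutral_projK x : neutral_val (neutral_proj x) = gr_proj gA 1%g x.
Proof. exact/vsprojK/gr_proj_mem. Qed.

Lemma neutral_proj_id x : x \in gA 1%g -> neutral_val (neutral_proj x) = x.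
Proof. by move=> xg; rewrite neutral_projK gr_proj_id. Qed.

Lemma neutral_proj_linear : linear neutral_proj.
Proof.
move=> c x y; apply: neutral_val_inj.
by rewrite linearP /= !neutral_projK linearP.
Qed.

HB.instance Definition _ :=
  GRing.isLinear.Build k A neutral _ neutral_proj neutral_proj_linear.

Definition neutral_mul (x y : neutral) : neutral :=
  neutral_proj (neutral_val x * neutral_val y).

Lemma neutral_mulE x y :
  neutral_val (neutral_mul x y) = neutral_val x * neutral_val y.
Proof.
apply: neutral_proj_id; rewrite -[1%g]mulg1.
by apply: grading_mul; apply: neutral_valP.
Qed.

Fact neutral_mulA : associative neutral_mul.
Proof. by move=> x y z; apply: neutral_val_inj; rewrite !neutral_mulE mulrA. Qed.

Fact neutral_mul1l : left_id (neutral_proj 1) neutral_mul.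
Proof.
move=> x; apply: neutral_val_inj.
by rewrite neutral_mulE neutral_proj_id ?one_neutral ?mul1r.
Qed.

Fact neutral_mul1r : right_id (neutral_proj 1) neutral_mul.
Proof.
move=> x; apply: neutral_val_inj.
by rewrite neutral_mulE neutral_proj_id ?one_neutral ?mulr1.
Qed.

Fact neutral_mulDl : left_distributive neutral_mul +%R.
Proof.
move=> x y z; apply: neutral_val_inj.
by rewrite linearD /= !neutral_mulE linearD mulrDl.
Qed.

Fact neutral_mulDr : right_distributive neutral_mul +%R.
Proof.
move=> x y z; apply: neutral_val_inj.
by rewrite linearD /= !neutral_mulE linearD mulrDr.
Qed.

Fact neutral_mulZl (c : k) x y : neutral_mul (c *: x) y = c *: neutral_mul x y.
Proof.
apply: neutral_val_inj.
by rewrite linearZ /= !neutral_mulE linearZ alg_scalerAl.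
Qed.

Fact neutral_mulZr (c : k) x y : neutral_mul x (c *: y) = c *: neutral_mul x y.
Proof.
apply: neutral_val_inj.
by rewrite linearZ /= !neutral_mulE linearZ alg_scalerAr.
Qed.

HB.instance Definition _ := Vector_isPzAlgebra.Build k neutral neutral_mulA
  neutral_mul1l neutral_mul1r neutral_mulDl neutral_mulDr
  neutral_mulZl neutral_mulZr.

Definition neutral_alg : finDimAlgType k := neutral.

Lemma neutral_valM (x y : neutral_alg) :
  neutral_val (x * y) = neutral_val x * neutral_val y.
Proof. exact: neutral_mulE. Qed.

Lemma neutral_regular :
  graded_von_neumann_regular gA -> von_neumann_regular neutral_alg.
Proof.
move=> reg x; have [b] := graded_regular_inverse reg (neutral_valP x).
rewrite invg1 => b1 xbx; exists (neutral_proj b).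
by apply: neutral_val_inj; rewrite !neutral_valM neutral_proj_id.
Qed.

(** If [a = a * b * a] is homogeneous and [l (x * a) = 0] for all [x] of inverse
    degree, then this holds for [x = y * b] with [y] neutral, so the neutral
    element [b * a] is zero by nondegeneracy on the neutral component. *)
Lemma graded_nondegenerate : graded_von_neumann_regular gA ->
  exists2 l : 'Hom(A, k^o), forall g x, x \in gA g -> g != 1%g -> l x = 0 &
    forall g a, a \in gA g ->
      (forall x, x \in gA (g^-1)%g -> l (x * a) = 0) -> a = 0.
Proof.
move=> reg; have [m m0] := regular_nondegenerate (neutral_regular reg).
exists (m \o linfun neutral_proj)%VF => [g x xg g1|g a ag a0].
  rewrite comp_lfunE lfunE /= [neutral_proj x](_ : _ = 0) ?linear0 //.
  apply: neutral_val_inj; rewrite neutral_projK linear0.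
  by apply: (gr_proj_neq xg); rewrite eq_sym.
have [b bg aba] := graded_regular_inverse reg ag.
have ba1 : b * a \in gA 1%g by rewrite -(mulVg g); apply: grading_mul.
rewrite -aba -mulrA -(neutral_proj_id ba1) [neutral_proj _](_ : _ = 0).
  by rewrite linear0 mulr0.
apply: m0 => x; have := a0 (neutral_val x * b).
rewrite comp_lfunE lfunE /= -mulrA => <-.
  congr (m _); apply: neutral_val_inj.
  rewrite neutral_valM neutral_proj_id // neutral_projK gr_proj_id //.
  by rewrite -[1%g]mulg1 grading_mul ?neutral_valP.
by rewrite -[(g^-1)%g]mul1g grading_mul ?neutral_valP.
Qed.

End NeutralComponent.

(** * The graded Frobenius property *)

Section Frobenius.
Variables (G : groupType) (k : fieldType) (A : finDimAlgType k).
Variable gA : grading G A.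

(** The isomorphism is [a |-> a l]. Its inverse preserves degrees because
    [(a l) x] depends, for [x] of degree [h], only on the component of [a] of
    degree [h^-1]: if [a l] is homogeneous of degree [g], then [a] and its
    component of degree [g] have the same image. *)
Lemma graded_regular_frobenius :
  graded_von_neumann_regular gA -> graded_frobenius gA.
Proof.
move=> /graded_nondegenerate[l l_deg l_nondeg].
have l_homog h x a : x \in gA h -> l (x * a) = l (x * gr_proj gA (h^-1)%g a).
  move=> xh; elim/(homogeneous_ind (gA := gA)): a => [|a b aE bE|g a ag].
  - by rewrite linear0.
  - by rewrite linearD /= !mulrDr !linearD /= aE bE.
  have [<-|hg] := eqVneq g (h^-1)%g; first by rewrite gr_proj_id.
  rewrite (gr_proj_neq ag) 1?eq_sym // mulr0 linear0.
  apply: l_deg (grading_mul xh ag) _.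
  by apply: contraNneq hg => hg1; rewrite -[(h^-1)%g]mulg1 -hg1 mulKg.
have inj a : (forall x, l (x * a) = 0) -> a = 0.
  move=> a0; rewrite -(gr_proj_sum gA a) big1 // => g _.
  apply: l_nondeg (gr_proj_mem gA g a) _ => x xg.
  by rewrite -[RHS](a0 x) (l_homog _ _ a xg) invgK.
have homog g (m : dual A) (a : A) : dual_comp gA g m ->
    (forall x, l (x * a) = dual_eval m x) -> a \in gA g.
  move=> mg aE; suff <- : gr_proj gA g a = a by apply: gr_proj_mem.
  apply/eqP; rewrite -subr_eq0; apply/eqP/inj => x.
  rewrite mulrBr linearB /=; apply/eqP; rewrite subr_eq0; apply/eqP.
  elim/(homogeneous_ind (gA := gA)): x => [|x y xE yE|h x xh].
  - by rewrite !mul0r.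
  - by rewrite !mulrDl !linearD /= xE yE.
  have [hg|hg] := eqVneq h (g^-1)%g.
    by rewrite (l_homog _ _ a xh) hg invgK.
  rewrite aE (mg h) //; apply: l_deg (grading_mul xh (gr_proj_mem gA g a)) _.
  by apply: contraNneq hg => hg1; rewrite -[h](mulgK g) hg1 mul1g.
pose phi := linfun (translate l).
have ker0 : (lker phi == 0)%VS.
  rewrite -subv0; apply/subvP => a /mem_lker_translate a0.
  by rewrite memv0 (inj a a0).
have im : limg phi = fullv.
  apply/eqP; rewrite eqEdim subvf /= limg_dim_eq ?(eqP ker0) ?capv0 //.
  (* The dimension of the dual is dim A * 1. *)
  by rewrite !dimvf /dim /= muln1.
pose f (a : regular_gr gA) : dual_gr gA := a *: (l : dual A).
have f_lin : linear f.
  by move=> a x y; rewrite /f scalerDl scalerA.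
pose f' (m : dual_gr gA) : regular_gr gA := (phi^-1)%VF m.
have fE x : f x = phi x by rewrite lfunE.
have f'K : cancel f' f.
  by move=> m; rewrite fE limg_lfunVK // im memvf.
have fK : cancel f f' by move=> a; rewrite /f' fE lker0_lfunK.
have f'_lin : linear f'.
  by move=> a x y; apply: (can_inj fK); rewrite f_lin !f'K.
pose F : {linear regular_gr gA -> dual_gr gA} :=
  HB.pack f (GRing.isLinear.Build _ _ _ _ f f_lin).
pose F' : {linear dual_gr gA -> regular_gr gA} :=
  HB.pack f' (GRing.isLinear.Build _ _ _ _ f' f'_lin).
exists F, F'; split=> //.
  move=> g a ag h hg x xh; rewrite [LHS]dual_actE.
  apply: l_deg (grading_mul xh ag) _.
  by apply: contraNneq hg => hg1; rewrite -[h](mulgK g) hg1 mul1g.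
move=> g m mg; apply: (homog g m) => // x.
by rewrite -[m in RHS]f'K [RHS]dual_actE.
Qed.

End Frobenius.

Theorem corollary4p5 (G : groupType) (k : fieldType) (A : finDimAlgType k)
    (gA : grading G A) :
  (graded_semisimple gA -> graded_frobenius gA) /\
  (graded_division gA -> graded_frobenius gA).
Proof.
split=> [ss|div]; apply: graded_regular_frobenius.
  exact: semisimple_regular.
exact: division_regular.
Qed.
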